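(* Let $p\ge 3$ be a prime number and let $N,M\in\mathbb N$. Let $E\subset \mathfrak G_M^\bot$ be an $(N,M)$-elementary set, let $\hat\varphi\in\mathfrak D_{-N}(\mathfrak G_M^\bot)$ be such that $|\hat\varphi(\chi)|=\mathbf 1_E(\chi)$, and suppose that $\hat\varphi$ is a solution of the equation $$\hat\varphi(\chi)=m_0(\chi)\,\hat\varphi(\chi\mathcal A^{-1}),$$ where $m_0$ is an $N$-elementary mask. Then there exists an $N$-valid rooted tree $T$ on the set $V=\{0,1,\dots,p-1\}$ with $\mathrm{height}(T)=M+2N$ that generates the set $E$.
   Context: **Group.** $p$ is a prime. $\mathfrak G$ (the $p$-adic Vilenkin group, operation $\dot+$, subtraction $\dot-$) is the group of sequences $x=(x_n)_{n\in\mathbb Z}$, $x_n\in\{0,\dots,p-1\}$, with only finitely many nonzero terms of negative index, added coordinatewise modulo $p$. Put $\mathfrak G_n=\{x: x_k=0 \text{ for } k<n\}$; these subgroups form a base of neighbourhoods of $0$. $g_n$ is the sequence with $1$ at place $n$ and $0$ elsewhere, so $x=\sum_n x_ng_n$ and $pg_n=0$. The dilation operator is $\mathcal A\bigl(\sum_n a_ng_n\bigr)=\sum_n a_ng_{n-1}$. **Characters.** $X$ is the multiplicative group of continuous characters of $\mathfrak G$; $(\chi,x)$ is the value of $\chi$ at $x$; $\mathfrak G_n^\bot=\{\chi\in X:(\chi,x)=1\ \forall x\in\mathfrak G_n\}$, an increasing sequence of subgroups with union $X$ and intersection $\{1\}$. The Rademacher characters are $(r_n,\sum_k a_kg_k)=\exp(2\pi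 i a_n/p)$, so $r_n\in\mathfrak G_{n+1}^\bot\setminus\mathfrak G_n^\bot$. $\chi\mathcal A$ is defined by $(\chi\mathcal A,x)=(\chi,\mathcal Ax)$ (so $r_n\mathcal A=r_{n+1}$), and $F\mathcal A^n=\{\chi\mathcal A^n:\chi\in F\}$ for $F\subset X$. $\mathfrak D_{-N}(\mathfrak G_M^\bot)$ is the set of step functions in $L_2(X)$ supported in $\mathfrak G_M^\bot$ and constant on cosets of $\mathfrak G_{-N}^\bot$. **$(N,M)$-elementary set.** $E\subset X$ is $(N,M)$-elementary if it is a disjoint union of $p^N$ cosets $\mathfrak G_{-N}^\bot\zeta_j=\mathfrak G_{-N}^\bot\xi_j\eta_j$, $j=0,\dots,p^N-1$, with $\xi_j=r_{-N}^{\alpha_{-N}}\cdots r_{-1}^{\alpha_{-1}}$, $\eta_j=r_0^{\alpha_0}\cdots r_{M-1}^{\alpha_{M-1}}$, all $\alpha_\nu\in\{0,\dots,p-1\}$, $j=\alpha_{-N}+\alpha_{-N+1}p+\dots+\alpha_{-1}p^{N-1}$ (the $\alpha_\nu$, $\nu\ge 0$, depending on $j$), such that (1) $\bigsqcup_{j}\mathfrak G_{-N}^\bot\xi_j=\mathfrak G_0^\bot$ and $\mathfrak G_{-N}^\bot\zeta_0=\mathfrak G_{-N}^\bot$; (2) $(\mathfrak G_{-N+l+1}^\bot\setminus\mathfrak G_{-N+l}^\bot)\cap E\neq\emptyset$ for every $l=0,\dots,M+N-1$. **$N$-elementary mask.** A function $m_0:X\to\mathbb C$ that is constant on cosets of $\mathfrak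 G_{-N}^\bot$, periodic with any period $r_1^{\alpha_1}\cdots r_s^{\alpha_s}$ ($s\in\mathbb N$, $\alpha_j\in\{0,\dots,p-1\}$), i.e. $m_0(\chi r_1^{\alpha_1}\cdots r_s^{\alpha_s})=m_0(\chi)$, whose absolute value takes only the values $0$ and $1$, and with $m_0(\mathfrak G_{-N}^\bot)=1$. **$N$-valid tree.** A rooted tree with vertices labelled by elements of $V=\{0,\dots,p-1\}$ (a label may occur at several vertices), edges directed away from the root, such that (1) the root and all vertices of levels $1,\dots,N-1$ have label $0$ (so the tree starts with a single chain of $N$ zeros; the root has level $0$); (2) for every $(\alpha_1,\dots,\alpha_N)\in V^N$ there is exactly one directed path of $N$ vertices in the tree whose successive labels are $\alpha_1\to\alpha_2\to\dots\to\alpha_N$. The height is the number of vertices in a longest directed path starting at the root. **Set generated by a tree.** Let $T$ be $N$-valid. For every directed path $(\alpha_s\to\alpha_{s-1}\to\dots\to\alpha_{-N})$ in $T$ with $\alpha_s=\alpha_{s-1}=\dots=\alpha_{s-N+1}=0$, take the cosets $$\mathfrak G_{-N}^\bot r_{-N}^{\alpha_{-N}}r_{-N+1}^{\alpha_{-N+1}}\cdots r_0^{\alpha_0},\ \ \mathfrak G_{-N}^\bot r_{-N}^{\alpha_{-N+1}}r_{-N+1}^{\alpha_{-N+2}}\cdots r_0^{\alpha_1},\ \dots,\ \mathfrak G_{-N}^\bot r_{-N}^{\alpha_{s-N}}\cdots r_0^{\alpha_s},$$ $$\mathfrak G_{-N}^\bot r_{-N}^{\alpha_{s-N+1}}\cdots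 r_{-1}^{\alpha_s},\ \ \mathfrak G_{-N}^\bot r_{-N}^{\alpha_{s-N+2}}\cdots r_{-2}^{\alpha_s},\ \dots,\ \mathfrak G_{-N}^\bot r_{-N}^{\alpha_s}$$ (the cosets of the second line all equal $\mathfrak G_{-N}^\bot$). Let $\tilde E\subset\mathfrak G_1^\bot$ be the union of all these cosets, and $\tilde E_X=\bigcup_{s\ge1}\bigsqcup_{\alpha_1,\dots,\alpha_s=0}^{p-1}\tilde E\,r_1^{\alpha_1}\cdots r_s^{\alpha_s}$ its periodic extension. The tree $T$ generates the set $E$ if $E=\bigcap_{n=0}^\infty\tilde E_X\mathcal A^n$. *)

(* Defs.v *)
From HB Require Import structures.
From mathcomp Require Import all_boot all_order all_algebra.
From mathcomp Require Import all_classical all_reals all_analysis.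
From mathcomp Require Import complex zify.
Set Implicit Arguments.
Unset Strict Implicit.
Unset Printing Implicit Defensive.
Import Order.TTheory GRing.Theory Num.Theory.
Import numFieldNormedType.Exports.
Local Open Scope classical_set_scope.
Local Open Scope ring_scope.

(* Digits live in 'F_p: for p prime its elements are exactly the ordinals
   0, ..., p - 1 and its addition is addition modulo p. *)
Definition vilenkin_pred (p : nat) : {pred int -> 'F_p} :=
  fun x => `[< finite_set [set k : int | k < 0 /\ x k != 0] >].

Lemma vilenkin_zmod_closed p : zmod_closed (@vilenkin_pred p).
Proof.
split=> [|x y /asboolP fx /asboolP fy]; apply/asboolP.
  by rewrite (_ : [set k | _] = set0) // -subset0 => k [_] /eqP.
apply: (@sub_finite_set _ _ ([set k : int | k < 0 /\ x k != 0] `|`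
                             [set k : int | k < 0 /\ y k != 0])).
  move=> k [k0] /=; change ((x - y) k) with (x k - y k) => xy0.
  have [x0|x0] := eqVneq (x k) 0; last by left.
  by right; split=> //; apply: contra xy0 => /eqP->; rewrite x0 subr0.
by rewrite finite_setU.
Qed.

HB.instance Definition _ p :=
  GRing.isZmodClosed.Build _ (@vilenkin_pred p) (@vilenkin_zmod_closed p).

Record vilenkin (p : nat) := Vilenkin {
  digit :> int -> 'F_p;
  _ : digit \in @vilenkin_pred p }.

HB.instance Definition _ p := [isSub for @digit p].
HB.instance Definition _ p := [Choice of vilenkin p by <:].
HB.instance Definition _ p := [SubChoice_isSubZmodule of vilenkin p by <:].

Definition Gsub (p : nat) (n : int) : set (vilenkin p) :=
  [set x | forall k : int, k < n -> x k = 0].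

Arguments Gsub : clear implicits.

Lemma vilenkinD p (x y : vilenkin p) k : (x + y) k = x k + y k.
Proof. by []. Qed.

Lemma vilenkin0 p k : (0 : vilenkin p) k = 0.
Proof. by []. Qed.

Definition vilenkin_nbhs p (x : vilenkin p) : set_system (vilenkin p) :=
  [set A | exists n : int, forall y, Gsub p n y -> A (x + y)].

HB.instance Definition _ p := hasNbhs.Build (vilenkin p) (@vilenkin_nbhs p).

Lemma Gsub_le p (m n : int) : m <= n -> Gsub p n `<=` Gsub p m.
Proof. by move=> mn x xn k km; apply/xn/(lt_le_trans km). Qed.

Lemma GsubD p n x y : Gsub p n x -> Gsub p n y -> Gsub p n (x + y).
Proof. by move=> nx ny k kn; rewrite vilenkinD nx // ny // addr0. Qed.

Lemma vilenkin_nbhs_filter p (x : vilenkin p) : ProperFilter (nbhs x).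
Proof.
apply: Build_ProperFilter_ex => [A [n An]|].
  by exists (x + 0); apply: An => k _; rewrite vilenkin0.
split=> [|A B [n An] [m Bm]|A B AB [n An]].
- by exists 0.
- exists (Num.max n m) => y ny; split.
    by apply/An/(Gsub_le _ ny); rewrite le_max lexx.
  by apply/Bm/(Gsub_le _ ny); rewrite le_max lexx orbT.
- by exists n => y /An /AB.
Qed.

Lemma vilenkin_nbhs_singleton p (x : vilenkin p) A : nbhs x A -> A x.
Proof. by move=> [n An]; rewrite -[x]addr0; apply: An => k _. Qed.

Lemma vilenkin_nbhs_nbhs p (x : vilenkin p) A :
  nbhs x A -> nbhs x (nbhs^~ A).
Proof.
move=> [n An]; exists n => y ny; exists n => z nz.
by rewrite -addrA; apply/An/GsubD.
Qed.

HB.instance Definition _ p := Nbhs_isNbhsTopological.Build (vilenkin p)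
  (@vilenkin_nbhs_filter p) (@vilenkin_nbhs_singleton p)
  (@vilenkin_nbhs_nbhs p).

Lemma shift_subproof p (m : int) (x : vilenkin p) :
  (fun k => x (k + m)) \in @vilenkin_pred p.
Proof.
case: x => x /= /asboolP fx; apply/asboolP.
pose B := [set j - m | j in [set k : int | k < 0 /\ x k != 0]].
pose D := [set (- n%:Z) | n in `I_(absz m).+1].
apply: (@sub_finite_set _ _ (B `|` D)).
  move=> k [k0 xk]; have [km|km] := ltP (k + m) 0.
    by left; exists (k + m) => //; rewrite addrK.
  by right; exists (absz k); rewrite /=; lia.
by rewrite finite_setU; split; apply: finite_image.
Qed.

(* [dilate] sends g_n to g_(n-1), so the k-th digit of the image is the
   (k+1)-st digit of x. *)
Definition dilate p (x : vilenkin p) : vilenkin p :=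
  Vilenkin (shift_subproof 1 x).

Definition dilateV p (x : vilenkin p) : vilenkin p :=
  Vilenkin (shift_subproof (-1) x).

Lemma dilateK p : cancel (@dilate p) (@dilateV p).
Proof.
move=> x; apply/val_inj/funext => k /=.
by rewrite subrK.
Qed.

Lemma dilateVK p : cancel (@dilateV p) (@dilate p).
Proof.
move=> x; apply/val_inj/funext => k /=.
by rewrite addrK.
Qed.

Lemma dilateD p : {morph @dilate p : x y / x + y}.
Proof. by move=> x y; apply/val_inj/funext. Qed.

Lemma dilateVD p : {morph @dilateV p : x y / x + y}.
Proof. by move=> x y; apply/val_inj/funext. Qed.

Lemma continuous_dilate p : continuous (@dilate p).
Proof.
move=> x A [n An]; exists (n + 1) => y ny; rewrite /= dilateD; apply: An.
by move=> k kn; apply: ny; rewrite ltrD2r.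
Qed.

Lemma continuous_dilateV p : continuous (@dilateV p).
Proof.
move=> x A [n An]; exists (n - 1) => y ny; rewrite /= dilateVD; apply: An.
by move=> k kn; apply: ny; rewrite ltrD2r.
Qed.

Record vchar (R : realType) (p : nat) := VChar {
  vchar_fun :> vilenkin p -> R[i];
  vcharD : forall x y, vchar_fun (x + y) = vchar_fun x * vchar_fun y;
  vchar_norm : forall x, `|vchar_fun x| = 1;
  vchar_continuous : continuous (vchar_fun : vilenkin p -> R[i]^o) }.

HB.instance Definition _ R p := gen_eqMixin (vchar R p).
HB.instance Definition _ R p := gen_choiceMixin (vchar R p).

Lemma vcharP R p (chi psi : vchar R p) : chi =1 psi -> chi = psi.
Proof.
case: chi psi => [f fD f1 fc] [g gD g1 gc] /= /funext fg.
by subst g; congr VChar; exact: Prop_irrelevance.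
Qed.

Section vchar_group.
Variables (R : realType) (p : nat).
Implicit Types chi psi : vchar R p.

Lemma vchar_neq0 chi x : chi x != 0.
Proof. by rewrite -normr_eq0 vchar_norm oner_eq0. Qed.

Definition vchar1 : vchar R p.
Proof.
refine (@VChar R p (fun=> 1) _ _ _) => [x y|x|x].
- by rewrite mulr1.
- by rewrite normr1.
- exact: cst_continuous.
Defined.

Definition vcharM chi psi : vchar R p.
Proof.
refine (@VChar R p (fun x => chi x * psi x) _ _ _) => [x y|x|x].
- by rewrite !vcharD mulrACA.
- by rewrite normrM !vchar_norm mulr1.
- by apply: (@continuousM (R[i] : numFieldType) (vilenkin p) chi psi);
    exact: vchar_continuous.
Defined.

Definition vcharV chi : vchar R p.
Proof.
refine (@VChar R p (fun x => (chi x)^-1) _ _ _) => [x y|x|x].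
- by rewrite vcharD invfM.
- by rewrite normfV vchar_norm invr1.
- apply: (@continuousV (R[i] : numFieldType) (vilenkin p) chi).
    exact: vchar_neq0.
  exact: vchar_continuous.
Defined.

Let vcharMA : associative vcharM.
Proof. by move=> x y z; apply: vcharP => t /=; rewrite mulrA. Qed.
Let vcharM1l : left_id vchar1 vcharM.
Proof. by move=> x; apply: vcharP => t /=; rewrite mul1r. Qed.
Let vcharM1r : right_id vchar1 vcharM.
Proof. by move=> x; apply: vcharP => t /=; rewrite mulr1. Qed.
Let vcharMVl : left_inverse vchar1 vcharV vcharM.
Proof. by move=> x; apply: vcharP => t /=; rewrite mulVf ?vchar_neq0. Qed.
Let vcharMVr : right_inverse vchar1 vcharV vcharM.
Proof. by move=> x; apply: vcharP => t /=; rewrite mulfV ?vchar_neq0. Qed.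

HB.instance Definition _ := isGroup.Build (vchar R p)
  vcharMA vcharM1l vcharM1r vcharMVl vcharMVr.

Lemma vcharME chi psi x : (chi * psi)%g x = chi x * psi x.
Proof. by []. Qed.

Lemma vchar1E x : (1%g : vchar R p) x = 1.
Proof. by []. Qed.

Lemma vcharVE chi x : (chi^-1)%g x = (chi x)^-1.
Proof. by []. Qed.

Lemma vcharMC chi psi : (chi * psi = psi * chi)%g.
Proof. by apply: vcharP => x; rewrite !vcharME mulrC. Qed.

Definition annihilator (n : int) : set (vchar R p) :=
  [set chi | forall x, Gsub p n x -> chi x = 1].

Definition chi_dilate chi : vchar R p.
Proof.
refine (@VChar R p (fun x => chi (dilate x)) _ _ _) => [x y|x|x].
- by rewrite dilateD vcharD.
- exact: vchar_norm.
- apply: (@continuous_comp _ _ _ (@dilate p) (chi : _ -> R[i]^o)).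
    exact: continuous_dilate.
  exact: vchar_continuous.
Defined.

Definition chi_dilateV chi : vchar R p.
Proof.
refine (@VChar R p (fun x => chi (dilateV x)) _ _ _) => [x y|x|x].
- by rewrite dilateVD vcharD.
- exact: vchar_norm.
- apply: (@continuous_comp _ _ _ (@dilateV p) (chi : _ -> R[i]^o)).
    exact: continuous_dilateV.
  exact: vchar_continuous.
Defined.

Lemma chi_dilateK : cancel chi_dilate chi_dilateV.
Proof. by move=> chi; apply: vcharP => x /=; rewrite dilateVK. Qed.

Lemma chi_dilateVK : cancel chi_dilateV chi_dilate.
Proof. by move=> chi; apply: vcharP => x /=; rewrite dilateK. Qed.

End vchar_group.

Arguments annihilator : clear implicits.

Definition cis (R : realType) (t : R) : R[i] := (cos t +i* sin t)%C.

Lemma cisD (R : realType) (s t : R) : cis (s + t) = cis s * cis t.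
Proof. by rewrite /cis cosD sinD [X in (_ +i* X)%C]addrC. Qed.

Lemma norm_cis (R : realType) (t : R) : `|cis t| = 1.
Proof. by rewrite normc_def /= cos2Dsin2 sqrtr1. Qed.

Lemma cis_2pi_nat (R : realType) (m : nat) : cis (2 * pi * m%:R : R) = 1.
Proof.
elim: m => [|m IH]; first by rewrite mulr0 /cis cos0 sin0.
by rewrite -[m.+1%:R]natr1 mulrDr cisD IH mul1r mulr1 mulr_natl /cis cos2pi sin2pi.
Qed.

Section rademacher.
Variables (R : realType) (p : nat) (p_pr : prime p).

Let pR_neq0 : p%:R != 0 :> R.
Proof. by rewrite pnatr_eq0 -lt0n prime_gt0. Qed.

Lemma cis_modp (m : nat) :
  cis (2 * pi * (m %% p)%:R / p%:R) = cis (2 * pi * m%:R / p%:R : R).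
Proof.
rewrite [in RHS](divn_eq m p) natrD natrM (mulrDr (2 * pi)).
rewrite (mulrDl (2 * pi * _)) cisD.
by rewrite (mulrA (2 * pi)) mulfK // cis_2pi_nat mul1r.
Qed.

Definition rademacher_fun (n : int) (x : vilenkin p) : R[i] :=
  cis (2 * pi * (x n : nat)%:R / p%:R).

Lemma rademacher_funD n x y :
  rademacher_fun n (x + y) = rademacher_fun n x * rademacher_fun n y.
Proof.
rewrite /rademacher_fun -cisD -mulrDl -(mulrDr (2 * pi)) -natrD.
rewrite -[RHS]cis_modp vilenkinD /=; congr (cis (_ * _%:R / _)).
exact: (congr1 (modn (x n + y n)) (Fp_cast p_pr)).
Qed.

Lemma rademacher_fun_continuous n :
  continuous (rademacher_fun n : vilenkin p -> R[i]^o).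
Proof.
move=> x A /nbhs_singleton Ax; exists (n + 1) => y ny /=.
rewrite rademacher_funD [X in _ * X](_ : _ = 1) ?mulr1 //.
by rewrite /rademacher_fun ny ?ltrDl // mulr0 mul0r /cis cos0 sin0.
Qed.

Definition rademacher (n : int) : vchar R p :=
  VChar (rademacher_funD n) (fun x => norm_cis _) (@rademacher_fun_continuous n).

Lemma rademacher_dilate n : chi_dilate (rademacher n) = rademacher (n + 1).
Proof. by apply: vcharP. Qed.

End rademacher.

Arguments rademacher R {p} p_pr n.

Section elementary.
Variables (R : realType) (p : nat) (p_pr : prime p).
Local Notation X := (vchar R p).
Local Notation Gperp := (annihilator R p).
Local Notation r := (rademacher R p_pr).

Definition coset_of_perp (n : int) (zeta : X) : set X :=
  [set (chi * zeta)%g | chi in Gperp n].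

(* [alpha j nu] is the exponent of r_nu in zeta_j; its values at
   nu = -N, ..., -1 are the base-p digits of j. *)
Definition elementary_xi (N : nat) (alpha : int -> 'F_p) : X :=
  (\prod_(i < N) r (i%:Z - N%:Z)%R ^+ alpha (i%:Z - N%:Z)%R)%g.

Definition elementary_eta (M : nat) (alpha : int -> 'F_p) : X :=
  (\prod_(i < M) r i%:Z ^+ alpha i%:Z)%g.

Definition elementary_set (N M : nat) (E : set X) : Prop :=
  exists alpha : 'I_(p ^ N) -> int -> 'F_p,
    let xi j := elementary_xi N (alpha j) in
    let zeta j := (xi j * elementary_eta M (alpha j))%g in
    [/\ forall j : 'I_(p ^ N),
          j = (\sum_(i < N) alpha j (i%:Z - N%:Z)%R * p ^ i)%N :> nat,
        trivIset setT (fun j => coset_of_perp (- N%:Z) (zeta j)) /\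
        E = \bigcup_j coset_of_perp (- N%:Z) (zeta j),
        trivIset setT (fun j => coset_of_perp (- N%:Z) (xi j)) /\
        \bigcup_j coset_of_perp (- N%:Z) (xi j) = Gperp 0,
        forall j : 'I_(p ^ N), j = 0%N :> nat ->
          coset_of_perp (- N%:Z) (zeta j) = Gperp (- N%:Z) &
        forall l : nat, (l < M + N)%N ->
          (Gperp (- N%:Z + l%:Z + 1) `\` Gperp (- N%:Z + l%:Z)) `&` E !=set0].

Definition coset_constant (n : int) (f : X -> R[i]) : Prop :=
  forall zeta chi : X, Gperp n zeta -> f (zeta * chi)%g = f chi.

Definition elementary_mask (N : nat) (m0 : X -> R[i]) : Prop :=
  [/\ coset_constant (- N%:Z) m0,
      forall (s : nat) (alpha : 'I_s -> 'F_p) (chi : X), (0 < s)%N ->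
        m0 (chi * \prod_(i < s) r i.+1%:Z ^+ alpha i)%g = m0 chi,
      forall chi, `|m0 chi| = 0 \/ `|m0 chi| = 1 &
      forall chi, Gperp (- N%:Z) chi -> m0 chi = 1].

(* G_M^perp is a finite union of cosets of G_(-N)^perp, each of finite Haar
   measure, so the functions below take finitely many values and lie in
   L_2(X) automatically. *)
Definition step_space (N M : nat) (f : X -> R[i]) : Prop :=
  (forall chi, ~ Gperp M%:Z chi -> f chi = 0) /\ coset_constant (- N%:Z) f.

Definition dilate_set (n : nat) (F : set X) : set X :=
  [set iter n (@chi_dilate R p) chi | chi in F].

Definition periodic_extension (F : set X) : set X :=
  \bigcup_(s in [set s | (0 < s)%N])
    \bigcup_(alpha in [set: 'I_s -> 'F_p])
      [set (chi * \prod_(i < s) r i.+1%:Z ^+ alpha i)%g | chi in F].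

End elementary.

(* A finite directed graph in which every vertex is reached from the root by
   exactly one directed walk: this is a rooted tree with its edges directed
   away from the root.  A walk from x is given by the sequence of the vertices
   following x. *)
Record rooted_tree (V : Type) := RootedTree {
  vertex :> finType;
  root : vertex;
  edge : rel vertex;
  label : vertex -> V;
  root_walk : forall v : vertex,
    exists! s : seq vertex, path edge root s /\ last root s = v }.

Section trees.
Variables (V : Type) (T : rooted_tree V).

Definition dipath (s : seq T) : bool := sorted (@edge V T) s.

Definition at_level (l : nat) (v : T) : Prop :=
  exists s : seq T,
    [/\ path (@edge V T) (root T) s, last (root T) s = v & size s = l].

Definition has_height (h : nat) : Prop :=
  (exists s : seq T, dipath (root T :: s) /\ size (root T :: s) = h) /\
  (forall s : seq T, dipath (root T :: s) -> (size (root T :: s) <= h)%N).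

End trees.

Definition valid_tree (p N : nat) (T : rooted_tree 'F_p) : Prop :=
  [/\ forall l (v : T), (l < N)%N -> at_level l v -> label v = 0,
      forall l, (l < N)%N -> exists! v : T, at_level l v &
      forall a : N.-tuple 'F_p,
        exists! s : seq T, dipath s /\ [seq label v | v <- s] = a].

Section generated_set.
Variables (R : realType) (p : nat) (p_pr : prime p).
Local Notation X := (vchar R p).
Local Notation r := (rademacher R p_pr).

(* For a path alpha_s -> ... -> alpha_(-N), the digit alpha_(i - N) is the i-th
   entry of [rev w], where w lists the labels from alpha_s on.  The j-th coset,
   0 <= j <= s + N, uses the window alpha_(j - N), ..., alpha_j, cut off at
   alpha_s: [nth] returns the exponent 0 beyond alpha_s. *)
Definition window (N : nat) (w : seq 'F_p) (j : nat) : X :=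
  (\prod_(i < N.+1) r (i%:Z - N%:Z)%R ^+ nth 0%R (rev w) (j + i))%g.

Definition tree_set (N : nat) (T : rooted_tree 'F_p) : set X :=
  [set chi | exists s : seq T,
    let w := [seq label v | v <- s] in
    [/\ dipath s, (N <= size s)%N, take N w = nseq N 0 &
        exists2 j, (j < size s)%N &
          coset_of_perp (- N%:Z) (window N w j) chi]].

Definition generates (N : nat) (T : rooted_tree 'F_p) (E : set X) : Prop :=
  E = \bigcap_n dilate_set n (periodic_extension p_pr (tree_set N T)).

End generated_set.

(* Main.v *)
Require Import Defs.
From HB Require Import structures.
From mathcomp Require Import all_boot all_order all_algebra.
From mathcomp Require Import all_classical all_reals all_analysis.
From mathcomp Require Import complex zify.
Set Implicit Arguments.
Unset Strict Implicit.
Unset Printing Implicit Defensive.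
Import Order.TTheory GRing.Theory Num.Theory.
Import numFieldNormedType.Exports.
Local Open Scope classical_set_scope.
Local Open Scope ring_scope.

(** A character is determined modulo [annihilator n] by its digits at the places
    [k >= n], so [E] amounts to a set of digit sequences indexed by
    [k >= -N], in which the first [N] digits (a word) determine all the others.
    Since [|phi| = 1_E] and [phi chi = m0 chi * phi (chi A^-1)], the set [E] is
    stable under the shift [A^-1], which therefore induces a map [next_word] on
    the words; every word reaches the zero word under iteration because [E] lies
    in [annihilator M].  The tree has the words as vertices, [next_word] as
    parent map and the first letter as label, with [N - 1] more zeros above the
    zero word.  Reading labels upwards from the vertex [x] gives the digits of
    the element of [E] that starts with [x]; hence the cosets given by the tree
    say that the digit at [0] is the one forced by the digits at [-N, ..., -1],
    and intersecting the dilates imposes this recursion at every place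
    [k >= 0], which characterizes [E]. *)

(** * Digits of characters *)

Section Digits.
Variables (R : realType) (p : nat) (p_pr : prime p).
Local Notation X := (vchar R p).
Local Notation r := (rademacher R p_pr).

Lemma cisX (t : R) (n : nat) : cis t ^+ n = cis (t * n%:R).
Proof.
elim: n => [|n IH]; first by rewrite mulr0 expr0 /cis cos0 sin0.
by rewrite exprSr IH -cisD -[n.+1%:R]natr1 mulrDr mulr1.
Qed.

Definition zeta_p : R[i] := cis (2 * pi / p%:R).

(** The order divides the prime [p], so it is [1] or [p]. Order [1] would give
    [cos (2 * pi / p) = cos 0], although [2 * pi / p] is a nonzero point of [[0, pi]], where [cos]
    is injective. *)
Lemma zeta_p_prim : p.-primitive_root zeta_p.
Proof.
have p_gt0 : 0 < p%:R :> R by rewrite ltr0n prime_gt0.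
have zp : zeta_p ^+ p = 1.
  by have := cis_2pi_nat R 1; rewrite mulr1 cisX divfK ?gt_eqF.
have [m mz mp] := prim_order_exists (prime_gt0 p_pr) zp.
have /orP[/eqP m1|/eqP <- //] := (primeP p_pr).2 m mp.
exfalso; move: mz; rewrite m1 => /prim_expr_order; rewrite expr1 => /eqP.
rewrite eq_complex /= => /andP[/eqP + _].
have pi_p : (2 * pi / p%:R : R) \in `[0, pi].
  rewrite in_itv /= divr_ge0 ?mulr_ge0 ?pi_ge0 ?ler0n //=.
  rewrite ler_pdivrMr // mulrC ler_wpM2l ?pi_ge0 //.
  by rewrite (ler_nat R 2) prime_gt1.
have pi_0 : (0 : R) \in `[0, pi] by rewrite in_itv /= lexx pi_ge0.
rewrite -[RHS]cos0 => cos_eq; have /eqP := cos_inj pi_p pi_0 cos_eq.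
by rewrite mulf_eq0 invr_eq0 mulf_eq0 !gt_eqF ?pi_gt0.
Qed.

Lemma rademacherE n x : r n x = zeta_p ^+ (x n).
Proof. by rewrite cisX /= /rademacher_fun mulrAC. Qed.

Lemma gen_subproof (k : int) :
  (fun j : int => (j == k)%:R) \in @vilenkin_pred p.
Proof.
apply/asboolP; apply: (@sub_finite_set _ _ [set k]) => // j [_] /=.
by have [|_ /eqP] := eqVneq j k.
Qed.

Definition gen (k : int) : vilenkin p := Vilenkin (gen_subproof k).

Lemma vilenkinMn (x : vilenkin p) n k : (x *+ n) k = x k *+ n.
Proof. by elim: n => // n IH; rewrite !mulrS vilenkinD IH. Qed.

Lemma vilenkinMp (x : vilenkin p) : x *+ p = 0.
Proof.
apply/val_inj/funext => k; rewrite -[LHS]/((x *+ p) k) vilenkinMn -mulr_natr.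
by rewrite pchar_Fp_0 // mulr0.
Qed.

Lemma vchar0E (chi : X) : chi 0 = 1.
Proof. by apply: (mulfI (vchar_neq0 chi 0)); rewrite -vcharD addr0 mulr1. Qed.

Lemma vcharMn (chi : X) x n : chi (x *+ n) = chi x ^+ n.
Proof. by elim: n => [|n IH]; rewrite ?vchar0E // mulrS vcharD IH exprS. Qed.

Lemma vcharXp (chi : X) x : chi x ^+ p = 1.
Proof. by rewrite -vcharMn vilenkinMp vchar0E. Qed.

(** Since [p g_k = 0], the value of [chi] at [gen k], which is $g_k$, is a [p]-th root of unity, so
    a suitable [a] always exists and the default [0] is never taken. *)
Definition chi_digit (chi : X) (k : int) : 'F_p :=
  odflt 0 [pick a : 'F_p | chi (gen k) == zeta_p ^+ a].

Lemma chi_digitP (chi : X) k : chi (gen k) = zeta_p ^+ chi_digit chi k.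
Proof.
rewrite /chi_digit; case: pickP => [a /eqP //|noa].
have [i xi] := prim_rootP zeta_p_prim (vcharXp chi (gen k)).
by have := noa (i%:R); rewrite val_Fp_nat // modn_small // xi eqxx.
Qed.

Lemma zeta_p_inj (a b : 'F_p) : zeta_p ^+ a = zeta_p ^+ b -> a = b.
Proof.
move=> /eqP; rewrite (eq_prim_root_expr zeta_p_prim) => /eqP ab.
apply/val_inj.
have lt_p (d : 'F_p) : (d < p)%N by rewrite -[X in (_ < X)%N](Fp_cast p_pr).
by move: ab; rewrite !modn_small.
Qed.

Lemma zeta_p_addF (a b : 'F_p) : zeta_p ^+ (a + b)%R = zeta_p ^+ a * zeta_p ^+ b.
Proof.
rewrite -exprD; apply/eqP; rewrite (eq_prim_root_expr zeta_p_prim).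
have -> : (a + b)%R = ((a + b) %% p)%N :> nat.
  exact: (congr1 (modn (a + b)%N) (Fp_cast p_pr)).
by rewrite modn_mod.
Qed.

Lemma chi_digit_unique (chi : X) k (a : 'F_p) :
  chi (gen k) = zeta_p ^+ a -> chi_digit chi k = a.
Proof. by rewrite chi_digitP => /zeta_p_inj. Qed.

Lemma chi_digitM chi psi k :
  chi_digit (chi * psi)%g k = chi_digit chi k + chi_digit psi k.
Proof.
by apply: chi_digit_unique; rewrite vcharME !chi_digitP zeta_p_addF.
Qed.

Lemma chi_digit1 k : chi_digit 1%g k = 0.
Proof. exact: chi_digit_unique. Qed.

Lemma chi_digitV chi k : chi_digit (chi^-1)%g k = - chi_digit chi k.
Proof.
by apply/eqP; rewrite -addr_eq0 -chi_digitM mulVg chi_digit1.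
Qed.

Lemma chi_digitX chi n k : chi_digit (chi ^+ n)%g k = chi_digit chi k *+ n.
Proof.
by elim: n => [|n IH]; rewrite ?chi_digit1 // expgS chi_digitM IH mulrS.
Qed.

Lemma chi_digit_prod (I : Type) (s : seq I) (P : pred I) (F : I -> X) k :
  chi_digit (\prod_(i <- s | P i) F i)%g k =
  \sum_(i <- s | P i) chi_digit (F i) k.
Proof.
exact: (big_morph (fun chi => chi_digit chi k)
  (fun chi psi => chi_digitM chi psi k) (chi_digit1 k)).
Qed.

Lemma chi_digit_rademacher n k : chi_digit (r n) k = (n == k)%:R.
Proof. by apply: chi_digit_unique; rewrite rademacherE. Qed.

Lemma chi_digit_rademacherX n (a : 'F_p) k :
  chi_digit (r n ^+ a)%g k = if n == k then a else 0.
Proof.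
rewrite chi_digitX chi_digit_rademacher; case: eqP => _; last by rewrite mul0rn.
by rewrite natr_Zp.
Qed.

Lemma chi_digit_rademacher_prod (n : nat) (F : 'I_n -> int) (a : 'I_n -> 'F_p) i :
  injective F -> chi_digit (\prod_(j < n) r (F j) ^+ a j)%g (F i) = a i.
Proof.
move=> F_inj; rewrite chi_digit_prod (bigD1 i) //=.
rewrite chi_digit_rademacherX eqxx big1 ?addr0 // => j ji.
by rewrite chi_digit_rademacherX (inj_eq F_inj) (negPf ji).
Qed.

Lemma chi_digit_rademacher_prod0 (n : nat) (F : 'I_n -> int) (a : 'I_n -> 'F_p) k :
  (forall j, F j != k) -> chi_digit (\prod_(j < n) r (F j) ^+ a j)%g k = 0.
Proof.
move=> Fk; rewrite chi_digit_prod; apply: big1 => j _.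
by rewrite chi_digit_rademacherX (negPf (Fk j)).
Qed.

Lemma dilateV_gen k : dilateV (gen k) = gen (k + 1).
Proof. by apply/val_inj/funext => j /=; rewrite subr_eq. Qed.

Lemma chi_digit_dilateV chi k :
  chi_digit (chi_dilateV chi) k = chi_digit chi (k + 1).
Proof.
by apply: chi_digit_unique; rewrite /= dilateV_gen chi_digitP.
Qed.

Lemma chi_digit_iter_dilateV n chi k :
  chi_digit (iter n (@chi_dilateV R p) chi) k = chi_digit chi (k + n%:Z).
Proof.
elim: n k => [|n IH] k; first by rewrite addr0.
by rewrite iterS chi_digit_dilateV IH -addrA; congr (chi_digit _ (_ + _)); lia.
Qed.

(* If [chi x != 1], the [p] powers of [chi x] sum to [0], so they cannot all be at
   distance less than [1] from [1]. *)
Lemma vchar_locally_trivial chi : exists n, annihilator R p n chi.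
Proof.
have /cvgr_dist_lt /(_ 1 ltr01) := @vchar_continuous R p chi 0.
rewrite vchar0E => -[n chi_lt1]; exists n => x nx.
apply/eqP; apply: contraT => chix1.
have nxi i : Gsub p n (x *+ i).
  by elim: i => [|i IH]; [move=> k _|rewrite mulrS; apply: GsubD].
have sum0 : \sum_(i < p) chi x ^+ i = 0.
  have /eqP := subrX1 (chi x) p; rewrite vcharXp subrr eq_sym mulf_eq0 subr_eq0.
  by rewrite (negPf chix1) /= => /eqP.
have sump : \sum_(i < p) (1 : R[i]) = p%:R by rewrite sumr_const card_ord.
suff : `|\sum_(i < p) (1 - chi x ^+ i)| < p%:R.
  by rewrite sumrB sum0 subr0 sump normr_nat ltxx.
apply: le_lt_trans (ler_norm_sum _ _ _) _; rewrite -sump.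
have p0 : (0 < p)%N := prime_gt0 p_pr.
apply: ltr_sum; first by apply/hasP; exists (Ordinal p0); rewrite ?mem_index_enum.
by move=> i _; have := chi_lt1 _ (nxi i); rewrite add0r vcharMn.
Qed.

Lemma annihilatorP n chi :
  annihilator R p n chi <-> forall k, n <= k -> chi_digit chi k = 0.
Proof.
split=> [nchi k nk|chi0].
  apply: chi_digit_unique; apply: nchi => j jn /=.
  by rewrite lt_eqF // (lt_le_trans jn).
(* By continuity [chi] is trivial on some [Gsub p m]. The bound then descends to [n] one place at a
   time: removing the term of [x] at place [k] does not change [chi x], because the digit of [chi]
   at [k] is [0]. *)
have [m mchi] := vchar_locally_trivial chi.
have {mchi} : annihilator R p (n + `|m - n|%N%:Z) chi.
  by move=> x mx; apply: mchi; apply: Gsub_le mx; lia.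
elim: `|_|%N => [|d IH]; first by rewrite addr0.
move=> chiS; apply: IH => x dx.
set k := n + d%:Z in dx.
rewrite -[x](subrK (gen k *+ x k)) vcharD vcharMn chi_digitP.
rewrite chi0 ?lerDl // expr0 expr1n mulr1; apply: chiS => j.
rewrite [_ < _](_ : _ = (j <= k)) => [|]; last by rewrite /k; lia.
rewrite vilenkinD => jk.
rewrite -[(- _ : vilenkin p) j]/(- (gen k *+ x k) j) vilenkinMn /=.
have [->|jk'] := eqVneq j k; first by rewrite natr_Zp subrr.
by rewrite mul0rn subr0 dx // lt_neqAle jk'.
Qed.

Lemma coset_of_perpP n (zeta chi : X) :
  coset_of_perp n zeta chi <->
  forall k, n <= k -> chi_digit chi k = chi_digit zeta k.
Proof.
split=> [[psi /annihilatorP psi0 <-] k nk|eqd].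
  by rewrite chi_digitM psi0 ?add0r.
exists (chi * zeta^-1)%g; last by rewrite -mulgA mulVg mulg1.
by apply/annihilatorP => k nk; rewrite chi_digitM chi_digitV eqd ?subrr.
Qed.

Lemma dilate_setP n (F : set X) chi :
  dilate_set n F chi <-> F (iter n (@chi_dilateV R p) chi).
Proof.
split=> [[psi Fpsi <-]|Fchi].
  elim: n => // n IH; rewrite iterSr iterS.
  by rewrite chi_dilateK.
exists (iter n (@chi_dilateV R p) chi) => //.
by elim: n {Fchi} => // n IH; rewrite iterSr iterS chi_dilateVK.
Qed.

End Digits.

(** * Rooted trees given by a parent map *)

Section ParentTree.
Variables (V : finType) (L : Type) (lab : V -> L) (root : V) (par : V -> V)
  (depth : V -> nat).
Hypothesis depth_root : forall v, (depth v == 0)%N = (v == root).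
Hypothesis depth_par : forall v, depth (par v) = (depth v).-1.

Definition parent_edge : rel V := [rel x y | (y != root) && (x == par y)].

Lemma depth_iter_par m v : depth (iter m par v) = (depth v - m)%N.
Proof. by elim: m => [|m IH]; rewrite ?subn0 // iterS depth_par IH subnS. Qed.

(** Read backwards, a directed path iterates [par] from its last vertex. The bound on [size s]
    expresses that no edge enters the root. *)
Lemma sorted_parent_edge s v :
  sorted parent_edge (rcons s v) =
  (rcons s v == rev (traject par v (size s).+1)) && (size s <= depth v)%N.
Proof.
elim/last_ind: s v => [|s u IH] v; first by rewrite /rev /= eqxx.
have -> : sorted parent_edge (rcons (rcons s u) v) =
    sorted parent_edge (rcons s u) && parent_edge u v.
  by case: s {IH} => [|x s]; rewrite /= ?andbT // rcons_path last_rcons.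
rewrite IH size_rcons [traject _ v _]/= rev_cons eqseq_rcons eqxx andbT /parent_edge /=.
have [-> /=|uv] := eqVneq u (par v); last first.
  rewrite !andbF; apply/esym/negbTE; apply: contra uv => /andP[+ _].
  by rewrite rev_cons eqseq_rcons => /andP[_ ->].
rewrite andbT -depth_root depth_par -andbA; congr (_ && _).
by case: (depth v) => [|d]; rewrite /= ?andbF ?andbT.
Qed.

Lemma parent_walkP s v :
  path parent_edge root s /\ last root s = v <->
  root :: s = rev (traject par v (depth v).+1).
Proof.
have split_last : root :: s = rcons (belast root s) (last root s).
  by rewrite lastI.
rewrite -[path _ _ _]/(sorted parent_edge (root :: s)) split_last.
split=> [[]|eqs].
  move: (last root s) (belast root s) (size_belast root s) split_last.
  move=> u t szt eqs + uv; rewrite {u}uv in eqs *.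
  rewrite sorted_parent_edge => /andP[/eqP eqt le_d]; rewrite eqt.
  (* The path starts at the root, the only vertex of depth [0], so it has at least [depth v] edges;
     the other inequality is [le_d]. *)
  suff -> : depth v = size t by [].
  have : root = iter (size t) par v.
    by move: eqs; rewrite eqt trajectSr rev_rcons => -[].
  move/eqP; rewrite eq_sym -depth_root depth_iter_par; lia.
have /(congr1 (last root)) : rcons (belast root s) (last root s) =
    rcons (rev (traject par (par v) (depth v))) v.
  by rewrite eqs /= rev_cons.
rewrite !last_rcons => lastv; split=> //.
rewrite sorted_parent_edge size_belast.
have sz : size s = depth v.
  by have := congr1 size eqs; rewrite size_rcons size_belast size_rev size_traject => -[].
by rewrite lastv sz leqnn andbT -lastv eqs lastv.
Qed.

Lemma parent_root_walk v :
  exists! s : seq V, path parent_edge root s /\ last root s = v.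
Proof.
have hd : iter (depth v) par v = root.
  by apply/eqP; rewrite -depth_root depth_iter_par subnn.
have eqt : rev (traject par v (depth v).+1) = root :: rev (traject par v (depth v)).
  by rewrite trajectSr rev_rcons hd.
exists (rev (traject par v (depth v))); split.
  by apply/parent_walkP.
by move=> s /parent_walkP; rewrite eqt => -[].
Qed.

Definition parent_tree : rooted_tree L := RootedTree lab parent_root_walk.

Lemma parent_at_level l (v : V) : at_level (T := parent_tree) l v <-> depth v = l.
Proof.
split=> [[s [ps ls <-]]|<-].
  have /parent_walkP/(congr1 size) := conj ps ls.
  by rewrite size_rev size_traject => -[].
have [s [[ps ls] _]] := parent_root_walk v; exists s; split=> //.
have /parent_walkP/(congr1 size) := conj ps ls.
by rewrite size_rev size_traject => -[].
Qed.

Lemma parent_dipathP (s : seq V) : (0 < size s)%N ->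
  dipath (T := parent_tree) s <->
  exists2 v, (size s <= (depth v).+1)%N & s = rev (traject par v (size s)).
Proof.
case/lastP: s => // s v _; rewrite /dipath [sorted _ _]sorted_parent_edge.
rewrite size_rcons; split=> [/andP[/eqP-> le_d]|[u]].
  by exists v; rewrite // size_rev size_traject.
rewrite ltnS => le_d eqs.
have /(congr1 (last root)) : rcons s v = rcons (rev (traject par (par u) (size s))) u.
  by rewrite eqs /= rev_cons.
by rewrite !last_rcons => vu; subst u; rewrite le_d andbT; apply/eqP.
Qed.

Lemma parent_has_height h :
  (forall v, (depth v < h)%N) -> (exists v, (depth v).+1 = h) ->
  has_height parent_tree h.
Proof.
move=> le_h [v dv]; split=> [|s].
  have [s [wv _]] := parent_root_walk v; exists s; case: (wv) => ps _; split=> //.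
  by rewrite -dv; move/parent_walkP/(congr1 size): wv; rewrite size_rev size_traject.
move/(parent_dipathP _) => /(_ isT) [u le_d _].
exact: leq_trans le_d (le_h u).
Qed.

End ParentTree.

(** * The tree of a shift-stable set of digit sequences *)

Section TrailTree.
Variables (p n L : nat).
Local Notation word := {ffun 'I_n.+1 -> 'F_p}.
(* [e x m] is the digit at the place [m - N], where [N = n.+1], of the elements
   of [E] whose first [N] digits are [x]. *)
Variable e : word -> nat -> 'F_p.

Definition next_word (x : word) : word := [ffun i : 'I_n.+1 => e x i.+1].

(** In the application, [e_next] is the stability of [E] under the shift, [e_eventually0] with
    [L = M + N] is the inclusion of [E] in [annihilator M], and [e_word0] holds because [E] contains
    the trivial character. *)
Hypothesis e_init : forall x (i : 'I_n.+1), e x i = x i.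
Hypothesis e_next : forall x m, e (next_word x) m = e x m.+1.
Hypothesis e_eventually0 : forall x m, (L <= m)%N -> e x m = 0.
Hypothesis e_word0 : forall m, e 0 m = 0.

Lemma next_word0 : next_word 0 = 0.
Proof. by apply/ffunP => i; rewrite !ffunE e_word0. Qed.

Lemma e_iter_next m x k : e (iter m next_word x) k = e x (m + k)%N.
Proof. by elim: m k => // m IH k; rewrite iterS e_next IH addnS. Qed.

Lemma e_inj x y : e x =1 e y -> x = y.
Proof. by move=> exy; apply/ffunP => i; rewrite -!e_init exy. Qed.

Lemma iter_next_L x : iter L next_word x = 0.
Proof. by apply: e_inj => k; rewrite e_iter_next e_word0 e_eventually0 ?leq_addr. Qed.

(** The zero word is fixed by [next_word] and is reached within [L] iterations, so this count of
    nonzero iterates is the time at which [x] first reaches zero. *)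
Definition steps (x : word) : nat := \sum_(m < L) (iter m next_word x != 0%R).

Lemma stepsE x : steps x = ((x != 0%R) + steps (next_word x))%N.
Proof.
have : (steps x + (iter L next_word x != 0%R) =
    (x != 0%R) + steps (next_word x))%N.
  (* A sum of [L.+1] terms is split at its last and at its first term; the last one vanishes by
     [iter_next_L]. *)
  transitivity (\sum_(m < L.+1) (iter m next_word x != 0%R) : nat).
    by rewrite big_ord_recr.
  rewrite big_ord_recl; congr addn; apply: eq_bigr => i _.
  by rewrite lift0 iterSr.
by rewrite iter_next_L eqxx addn0.
Qed.

Lemma steps0 : steps 0 = 0%N.
Proof.
by apply: big1 => m _; rewrite (_ : iter m _ _ = 0) ?eqxx //;
  elim: (m : nat) => // k /= ->; exact: next_word0.
Qed.

Lemma steps_eq0 x : (steps x == 0)%N = (x == 0).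
Proof.
have [->|x0] := eqVneq x 0; first by rewrite steps0.
by rewrite stepsE x0.
Qed.

Lemma steps_next x : steps (next_word x) = (steps x).-1.
Proof.
have [->|x0] := eqVneq x 0; first by rewrite next_word0 steps0.
by rewrite (stepsE x) x0.
Qed.

Lemma steps_iter m x : steps (iter m next_word x) = (steps x - m)%N.
Proof. by elim: m => [|m IH]; rewrite ?subn0 // iterS steps_next IH subnS. Qed.

Lemma steps_le x : (steps x <= L)%N.
Proof.
rewrite -[leqRHS]card_ord -sum1_card; apply: leq_sum => i _; exact: leq_b1.
Qed.

Lemma steps_gt x m : e x m != 0 -> (m < steps x)%N.
Proof.
move=> exm; rewrite ltnNge -subn_eq0 -steps_iter steps_eq0.
by apply: contra exm => /eqP it0; rewrite -[m]addn0 -e_iter_next it0 e_word0.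
Qed.

(* The vertex [(i, 0)] with [i < n] is the zero at level [i] of the initial chain;
   the vertex of the word [x] is [(n, x)]. *)
Definition trail_pred : pred ('I_n.+1 * word) :=
  fun v => (v.1 == ord_max) || (v.2 == 0).

Definition trail_vertex := {v | trail_pred v}.
Implicit Types v : trail_vertex.

Lemma trail_pred0 i : trail_pred (i, 0).
Proof. by rewrite /trail_pred eqxx orbT. Qed.

Lemma trail_pred_max x : trail_pred (ord_max, x).
Proof. by rewrite /trail_pred eqxx. Qed.

Definition zero_vertex i : trail_vertex := Sub _ (trail_pred0 i).

Definition word_vertex x : trail_vertex := Sub _ (trail_pred_max x).

Definition trail_root : trail_vertex := zero_vertex ord0.

(** The zero word hangs from the initial chain, and the root is its own parent because
    [0.-1 = 0]. *)
Definition parent_pair (v : 'I_n.+1 * word) : 'I_n.+1 * word :=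
  if v.2 == 0 then (inord v.1.-1, 0) else (v.1, next_word v.2).

Lemma parent_pair_closed v : trail_pred (parent_pair (val v)).
Proof.
case: v => [[i x]]; rewrite /parent_pair /trail_pred /=.
by case: (eqVneq x 0) => /= [_|_]; rewrite ?eqxx ?orbT ?orbF // => ->.
Qed.

Definition trail_parent v : trail_vertex := Sub _ (parent_pair_closed v).

Definition word_of v : word := (val v).2.

Definition trail_depth v : nat := ((val v).1 + steps (val v).2)%N.

Lemma word_of_parent v : word_of (trail_parent v) = next_word (word_of v).
Proof.
rewrite /word_of /= /parent_pair; case: (eqVneq (val v).2 0) => //= ->.
by rewrite next_word0.
Qed.

Lemma trail_depth_root v : (trail_depth v == 0)%N = (v == trail_root).
Proof. by rewrite -val_eqE addn_eq0 steps_eq0. Qed.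

Lemma trail_depth_parent v : trail_depth (trail_parent v) = (trail_depth v).-1.
Proof.
rewrite /trail_depth /= /parent_pair.
case: v => [[i x]] /= iv; have [->|x0] /= := eqVneq x 0.
  by rewrite steps0 !addn0 inordK // (leq_ltn_trans (leq_pred _)).
by rewrite (stepsE x) x0 addnS.
Qed.

Definition trail_tree : rooted_tree 'F_p :=
  parent_tree (fun v => e (word_of v) 0) trail_depth_root trail_depth_parent.

Lemma labels_traject v m :
  [seq e (word_of u) 0 | u <- traject trail_parent v m] = mkseq (e (word_of v)) m.
Proof.
apply: (@eq_from_nth _ 0); rewrite size_map size_traject ?size_mkseq // => i im.
rewrite (nth_map v) ?size_traject // nth_traject // nth_mkseq //.
have -> : word_of (iter i trail_parent v) = iter i next_word (word_of v).
  by elim: i {im} => // i IH; rewrite iterS word_of_parent IH.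
by rewrite e_iter_next addn0.
Qed.

Lemma trail_dipathP (s : seq trail_tree) : (0 < size s)%N -> dipath s ->
  exists2 v, (size s <= (trail_depth v).+1)%N &
    s = rev (traject trail_parent v (size s)).
Proof. by move=> s0 /parent_dipathP; apply. Qed.

Lemma trail_labels (s : seq trail_vertex) v : s = rev (traject trail_parent v (size s)) ->
  [seq @label _ trail_tree u | u <- s] = rev (mkseq (e (word_of v)) (size s)).
Proof. by move=> {1}->; rewrite map_rev labels_traject. Qed.

Lemma word_vertex_depth x : trail_depth (word_vertex x) = (n + steps x)%N.
Proof. by []. Qed.

(** Strictly inside the initial chain the depth is the level, which is less than [n]. *)
Lemma word_vertexK v : (n <= trail_depth v)%N -> word_vertex (word_of v) = v.
Proof.
rewrite /trail_depth => nv; apply/val_inj; rewrite SubK /word_of; move: nv.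
case: v => [[i x]] /= /orP[] /= /eqP-> //; rewrite steps0 addn0 => ni.
congr pair; apply/val_inj => /=; apply/eqP; rewrite eqn_leq ni.
by rewrite -ltnS ltn_ord.
Qed.

Lemma trail_depth_small v : (trail_depth v <= n)%N -> word_of v = 0.
Proof.
move=> vn; apply/eqP; rewrite -steps_eq0; move: vn; rewrite /trail_depth /word_of.
case: v => [[i x]] /= /orP[] /= /eqP->; last by rewrite steps0.
by rewrite -[leqRHS]addn0 leq_add2l leqn0.
Qed.

Lemma trail_valid : valid_tree n.+1 trail_tree.
Proof.
split=> [l v ln /parent_at_level dv|l ln|a].
- by rewrite /= trail_depth_small ?e_word0 // dv.
- exists (zero_vertex (Ordinal ln)); split.
    by apply/parent_at_level; rewrite /trail_depth /= steps0 addn0.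
  move=> v /parent_at_level dv; apply/val_inj.
  have v0 : (val v).2 = 0 by apply: trail_depth_small; rewrite dv -ltnS.
  move: dv; rewrite /trail_depth v0 steps0 addn0 => dv.
  rewrite [RHS]surjective_pairing v0; congr pair; exact/val_inj.
(* Paths run away from the root while a word is read towards it, hence the reversal. *)
pose x : word := [ffun i => tnth a (rev_ord i)].
have ax : rev (mkseq (e x) n.+1) = a.
  apply: (@eq_from_nth _ 0) => [|i]; rewrite size_rev size_mkseq ?size_tuple // => ia.
  rewrite nth_rev size_mkseq // nth_mkseq ?ltn_subrL //.
  have -> : (n.+1 - i.+1)%N = rev_ord (Ordinal ia) by [].
  by rewrite e_init ffunE rev_ordK (tnth_nth 0).
pose s := rev (traject trail_parent (word_vertex x) n.+1).
have szs : size s = n.+1 by rewrite size_rev size_traject.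
exists s; split.
  split; last by rewrite (@trail_labels _ (word_vertex x)) szs.
  by apply/parent_dipathP; rewrite ?szs //; exists (word_vertex x); rewrite ?leq_addr.
move=> t [dt lt].
have szt : size t = n.+1 by rewrite -(size_map (@label _ trail_tree)) lt size_tuple.
have [|v dv tv] := trail_dipathP _ dt; first by rewrite szt.
rewrite szt ltnS in dv tv.
(* A path of [n.+1] vertices ends at depth at least [n], hence at a word vertex, and its labels
   spell that word. *)
rewrite tv /s; congr (rev (traject _ _ _)); rewrite -(word_vertexK dv).
congr word_vertex; apply/ffunP => i.
have := lt; rewrite (@trail_labels _ v) szt // -ax => /(congr1 rev).
rewrite !revK => /(congr1 (nth 0 ^~ i)).
by rewrite !nth_mkseq // !e_init.
Qed.

(** No depth exceeds [n + L], and a nonzero digit at place [L.-1] forces [steps x = L]. The height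
    counts vertices, one more than the depth. *)
Lemma trail_height x : e x L.-1 != 0 -> has_height trail_tree (n.+1 + L).
Proof.
move=> ex; apply: parent_has_height => [v|].
  by rewrite addSn ltnS leq_add ?steps_le // -ltnS.
exists (word_vertex x); rewrite word_vertex_depth addSn; congr (_ + _).+1.
apply/eqP; rewrite eqn_leq steps_le /=.
by apply: leq_trans (leqSpred _) (steps_gt ex).
Qed.

Lemma trail_path_from_zero (s : seq trail_vertex) :
  dipath (T := trail_tree) s -> (n < size s)%N ->
  take n.+1 [seq @label _ trail_tree v | v <- s] = nseq n.+1 0 ->
  exists x, forall k, nth 0 (rev [seq @label _ trail_tree v | v <- s]) k = e x k.
Proof.
move=> ds ns; have s0 : (0 < size s)%N by apply: leq_ltn_trans ns.
have [v dv sv] := trail_dipathP s0 ds.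
rewrite (trail_labels sv) => top0; exists (word_of v) => k; rewrite revK.
have [ks|sk] := ltnP k (size s); first by rewrite nth_mkseq.
rewrite nth_default ?size_mkseq //.
(* The top [n.+1] labels are the letters of this iterate. As it is zero, all later digits vanish, in
   agreement with the default value of [nth] past the top of the path. *)
have it0 : iter (size s - n.+1) next_word (word_of v) = 0.
  apply/ffunP => i; rewrite -e_init e_iter_next ffunE.
  have := congr1 (nth 0 ^~ (n - i)%N) top0.
  rewrite nth_nseq if_same nth_take ?ltnS ?leq_subr // nth_rev size_mkseq; last first.
    by rewrite (leq_ltn_trans (leq_subr _ _)).
  have ik : (size s - (n - i).+1 = size s - n.+1 + i)%N by have := ltn_ord i; lia.
  rewrite ik nth_mkseq //; have := ltn_ord i; lia.
have -> : k = (size s - n.+1 + (k - (size s - n.+1)))%N by lia.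
by rewrite -e_iter_next it0 e_word0.
Qed.

Lemma trail_path_to_word x : exists s : seq trail_tree,
  [/\ dipath s, (n < size s)%N,
    take n.+1 [seq @label _ trail_tree v | v <- s] = nseq n.+1 0 &
    forall k, nth 0 (rev [seq @label _ trail_tree v | v <- s]) k = e x k].
Proof.
(* This is the number of vertices on the whole path from the root to the vertex of [x]. Its top
   [n.+1] labels are digits at places from [steps x] on, which are all zero. *)
pose m := (n + steps x).+1.
pose s := rev (traject trail_parent (word_vertex x) m).
have szs : size s = m by rewrite size_rev size_traject.
have e0 k : (steps x <= k)%N -> e x k = 0.
  by move=> xk; apply/eqP; apply: contraTT xk => /steps_gt; rewrite ltnNge.
have ls : [seq @label _ trail_tree v | v <- s] = rev (mkseq (e x) m).
  by rewrite (@trail_labels _ (word_vertex x)) szs.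
exists s; rewrite ls szs; split.
- by apply/parent_dipathP; rewrite szs //; exists (word_vertex x).
- by rewrite ltnS leq_addr.
- have sz : size (take n.+1 (rev (mkseq (e x) m))) = n.+1.
    by rewrite size_takel // size_rev size_mkseq ltnS leq_addr.
  apply: (@eq_from_nth _ 0) => [|i]; rewrite sz ?size_nseq // => im.
  rewrite nth_nseq if_same nth_take // nth_rev size_mkseq; last by rewrite /m; lia.
  by rewrite nth_mkseq ?e0 // /m; lia.
- move=> k; rewrite revK; have [km|mk] := ltnP k m; first by rewrite nth_mkseq.
  by rewrite nth_default ?size_mkseq // e0 //; move: mk; rewrite /m; lia.
Qed.

End TrailTree.

(** * The set generated by the tree *)

Section WindowDigits.
Variables (R : realType) (p : nat) (p_pr : prime p).
Local Notation X := (vchar R p).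
Local Notation r := (rademacher R p_pr).

Lemma chi_digit_window N (w : seq 'F_p) j (i : 'I_N.+1) :
  chi_digit (window R p_pr N w j) (i%:Z - N%:Z) = nth 0 (rev w) (j + i).
Proof.
have inj : injective (fun i : 'I_N.+1 => i%:Z - N%:Z).
  by move=> a b ab; apply/val_inj => /=; lia.
exact: (@chi_digit_rademacher_prod R p p_pr _ _
  (fun i => nth 0 (rev w) (j + i)) i inj).
Qed.

Lemma chi_digit_window0 N (w : seq 'F_p) j k : 0 < k ->
  chi_digit (window R p_pr N w j) k = 0.
Proof.
move=> k0; apply: chi_digit_rademacher_prod0.
by move=> i; apply/eqP; have := ltn_ord i; lia.
Qed.

Lemma chi_digit_xi N (alpha : int -> 'F_p) k :
  chi_digit (elementary_xi R p_pr N alpha) k =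
  if (- N%:Z <= k) && (k < 0) then alpha k else 0.
Proof.
case: ifP => [/andP[Nk k0]|kN]; last first.
  apply: chi_digit_rademacher_prod0 => i.
  by apply/eqP; have := ltn_ord i; lia.
have iN : (absz (k + N%:Z)%R < N)%N by lia.
have -> : k = (Ordinal iN : nat)%:Z - N%:Z by rewrite /=; lia.
have inj : injective (fun i : 'I_N => i%:Z - N%:Z).
  by move=> a b ab; apply/val_inj => /=; lia.
exact: (@chi_digit_rademacher_prod R p p_pr _ _
  (fun i : 'I_N => alpha (i%:Z - N%:Z)) _ inj).
Qed.

Lemma chi_digit_eta M (alpha : int -> 'F_p) k :
  chi_digit (elementary_eta R p_pr M alpha) k =
  if (0 <= k) && (k < M%:Z) then alpha k else 0.
Proof.
case: ifP => [/andP[k0 kM]|kM]; last first.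
  apply: chi_digit_rademacher_prod0 => i.
  by apply/eqP; have := ltn_ord i; lia.
have iM : (`|k|%N < M)%N by lia.
have -> : k = (Ordinal iM : nat)%:Z by rewrite /=; lia.
have inj : injective (fun i : 'I_M => i%:Z).
  by move=> a b ab; apply/val_inj => /=; lia.
exact: (@chi_digit_rademacher_prod R p p_pr _ _
  (fun i : 'I_M => alpha i%:Z) _ inj).
Qed.

Lemma chi_digit_period s (alpha : 'I_s -> 'F_p) (i : 'I_s) :
  chi_digit (\prod_(i < s) r i.+1%:Z ^+ alpha i)%g i.+1%:Z = alpha i.
Proof.
have inj : injective (fun i : 'I_s => i.+1%:Z).
  by move=> a b ab; apply/val_inj => /=; lia.
exact: (@chi_digit_rademacher_prod R p p_pr _ _ alpha _ inj).
Qed.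

Lemma chi_digit_period0 s (alpha : 'I_s -> 'F_p) k : k <= 0 ->
  chi_digit (\prod_(i < s) r i.+1%:Z ^+ alpha i)%g k = 0.
Proof.
move=> k0; apply: chi_digit_rademacher_prod0.
by move=> i; apply/eqP; lia.
Qed.

(** Periods alter only digits at positive places. A character has finitely many nonzero digits
    there, so one period removes them all: the extension forgets exactly the positive places. *)
Lemma periodic_extensionP (F : set X) (P : (int -> 'F_p) -> Prop) :
  (forall a b : int -> 'F_p, (forall k, k <= 0 -> a k = b k) -> P a -> P b) ->
  (forall chi, F chi <-> (forall k, 0 < k -> chi_digit chi k = 0) /\
                         P (chi_digit chi)) ->
  forall chi, periodic_extension p_pr F chi <-> P (chi_digit chi).
Proof.
move=> P_local FP chi; split.
  move=> [s /= s0 [alpha _ [psi /FP[_ Ppsi] <-]]].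
  apply: P_local Ppsi => k k0.
  by rewrite chi_digitM // (chi_digit_period0 alpha k0) addr0.
move=> Pchi; have [m mchi] := vchar_locally_trivial p_pr chi.
have chi0 k : m <= k -> chi_digit chi k = 0 by move: k; apply/(annihilatorP p_pr).
(* The successor makes [s] positive; beyond place [s] the digits of [chi] vanish because
   [m <= s]. *)
pose s := `|m|%N.+1; pose alpha (i : 'I_s) := chi_digit chi i.+1%:Z.
exists s => //; exists alpha => //.
set per := (\prod_(i < s) r i.+1%:Z ^+ alpha i)%g.
exists (chi * per^-1)%g; last by rewrite -mulgA mulVg mulg1.
apply/FP; split=> [k k0|]; last first.
  apply: P_local Pchi => k k0; rewrite chi_digitM // chi_digitV //.
  by rewrite (chi_digit_period0 alpha k0) subr0.
rewrite chi_digitM // chi_digitV //.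
have [ks|sk] := ltP k s.+1%:Z.
  have is' : (`|k|%N.-1 < s)%N by lia.
  have kE : k = (Ordinal is').+1%:Z by rewrite /=; lia.
  by rewrite [in X in _ - X]kE (chi_digit_period alpha) /alpha -kE subrr.
rewrite chi0; last by rewrite /s in sk; lia.
rewrite chi_digit_rademacher_prod0 ?subr0 //.
by move=> i; apply/eqP; have := ltn_ord i; lia.
Qed.

End WindowDigits.

(** * Intersecting the dilates recovers the whole digit sequence *)

Section TrailGenerates.
Variables (R : realType) (p : nat) (p_pr : prime p) (n L : nat).
Local Notation word := {ffun 'I_n.+1 -> 'F_p}.
Variable e : word -> nat -> 'F_p.
Hypothesis e_init : forall x (i : 'I_n.+1), e x i = x i.
Hypothesis e_next : forall x m, e (next_word e x) m = e x m.+1.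
Hypothesis e_eventually0 : forall x m, (L <= m)%N -> e x m = 0.
Hypothesis e_word0 : forall m, e 0 m = 0.
Local Notation T := (trail_tree e_init e_next e_eventually0 e_word0).

(** By [e_init], [x] can only be the word of the digits at the [n.+1] places before [0], so the
    condition constrains just the digit at [0]. *)
Definition first_window_on_trail (d : int -> 'F_p) : Prop :=
  exists x, forall i, (i <= n.+1)%N -> d (i%:Z - n.+1%:Z) = e x i.

Lemma tree_set_trailP (chi : vchar R p) :
  tree_set p_pr n.+1 T chi <->
  (forall k, 0 < k -> chi_digit chi k = 0) /\
  first_window_on_trail (chi_digit chi).
Proof.
split.
  move=> [s /= [ds ns top0 [j js /(coset_of_perpP p_pr) chiE]]].
  have [x xE] := trail_path_from_zero ds ns top0.
  split=> [k k0|]; first by rewrite chiE ?chi_digit_window0 //; lia.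
  (* The [j]-th window along the path is the initial window of the [j]-th shifted word. *)
  exists (iter j (next_word e) x) => i iN.
  rewrite chiE ?(chi_digit_window _ _ _ _ (Ordinal (iN : (i < n.+2)%N))); last by lia.
  by rewrite xE (e_iter_next e_next).
move=> [chi0 [x xE]].
have [s [ds ns top0 sE]] := trail_path_to_word e_init e_next e_eventually0 e_word0 x.
(* The path from the root down to [x] already gives the coset as its window number [0]. *)
exists s; split=> //; exists 0%N; first exact: leq_ltn_trans ns.
apply/(coset_of_perpP p_pr) => k Nk.
have [k0|k0] := ltP 0 k; first by rewrite chi0 // chi_digit_window0.
have iN : (absz (k + n.+1%:Z)%R < n.+2)%N by lia.
have -> : k = (Ordinal iN : nat)%:Z - n.+1%:Z by rewrite /=; lia.
by rewrite chi_digit_window sE xE.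
Qed.

Lemma generates_trail_tree (E : set (vchar R p)) :
  (forall chi, E chi <-> exists x, forall m, chi_digit chi (m%:Z - n.+1%:Z) = e x m) ->
  generates p_pr n.+1 T E.
Proof.
move=> EP.
have window_local (a b : int -> 'F_p) : (forall k, k <= 0 -> a k = b k) ->
    first_window_on_trail a -> first_window_on_trail b.
  by move=> ab [x xE]; exists x => i iN; rewrite -ab ?xE //; lia.
have extP := periodic_extensionP p_pr window_local tree_set_trailP.
have interP (chi : vchar R p) :
    (\bigcap_m dilate_set m (periodic_extension p_pr (tree_set p_pr n.+1 T))) chi <->
   forall m, first_window_on_trail (fun k => chi_digit chi (k + m%:Z)).
  split=> [chiE m|chiE m _].
    have /dilate_setP/extP [x xE] := chiE m I; exists x => i iN.
    by rewrite -xE // chi_digit_iter_dilateV.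
  apply/dilate_setP/extP; have [x xE] := chiE m; exists x => i iN.
  by rewrite chi_digit_iter_dilateV //; exact: xE.
rewrite /generates predeqE => chi; rewrite interP EP; split.
  move=> [x xE] m; exists (iter m (next_word e) x) => i _.
  by rewrite (e_iter_next e_next) -xE; congr chi_digit; lia.
(* [y m] is the word seen in the window ending at place [m]. Windows have one digit more than words,
   so each determines the next word, and all the [y m] are iterates of [y 0]. *)
move=> /choice [y yE]; exists (y 0%N).
have y_next m : y m.+1 = next_word e (y m).
  apply/ffunP => i; rewrite ffunE -e_init -yE -?yE; last 2 first.
  - exact: ltn_ord.
  - by apply: ltnW; exact: ltn_ord.
  by congr chi_digit; lia.
have y_iter m : y m = iter m (next_word e) (y 0%N).
  by elim: m => // m IH; rewrite iterS -IH y_next.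
move=> m; rewrite -[m in e _ m]addn0 -(e_iter_next e_next) -y_iter -yE //.
by congr chi_digit; lia.
Qed.

End TrailGenerates.

(** * Elementary sets in terms of digits *)

Section ElementaryTrail.
Variables (R : realType) (p : nat) (p_pr : prime p) (N M : nat).
Local Notation X := (vchar R p).

(** The factor [elementary_eta] has no digits at negative places, so the word of [zeta j] is that of
    [elementary_xi]. Every word occurs because the cosets of the latter cover [annihilator 0], and a
    word determines [j] through its base [p] expansion. *)
Lemma elementary_set_digits (E : set X) : elementary_set p_pr N M E ->
  [/\ forall chi psi : X, E chi ->
        (forall k, - N%:Z <= k -> chi_digit psi k = chi_digit chi k) -> E psi,
      E 1%g,
      forall x : 'I_N -> 'F_p, exists2 chi, E chi &
        forall i : 'I_N, chi_digit chi (i%:Z - N%:Z) = x i &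
      forall chi psi, E chi -> E psi ->
        (forall i : 'I_N, chi_digit chi (i%:Z - N%:Z) = chi_digit psi (i%:Z - N%:Z)) ->
        forall k, - N%:Z <= k -> chi_digit chi k = chi_digit psi k].
Proof.
move=> [alpha [jE [_ EE] [_ xi_cover] zeta0 _]].
pose zeta j := (elementary_xi R p_pr N (alpha j) * elementary_eta R p_pr M (alpha j))%g.
have inE chi : E chi <-> exists j, forall k, - N%:Z <= k ->
    chi_digit chi k = chi_digit (zeta j) k.
  rewrite EE; split=> [[j _ /(coset_of_perpP p_pr) ?]|[j ?]]; exists j => //.
  exact/(coset_of_perpP p_pr).
have zeta_low j (i : 'I_N) : chi_digit (zeta j) (i%:Z - N%:Z) = alpha j (i%:Z - N%:Z).
  rewrite chi_digitM // chi_digit_xi chi_digit_eta; have := ltn_ord i => iN.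
  by rewrite ifT ?ifF ?addr0 //; lia.
split.
- move=> chi psi /inE[j chij] eqd; apply/inE; exists j => k Nk.
  by rewrite eqd // chij.
- have j0 : (0 < p ^ N)%N by rewrite expn_gt0 prime_gt0.
  by rewrite EE; exists (Ordinal j0) => //; rewrite zeta0.
- move=> x; pose a (k : int) := odflt 0 (omap x (insub (absz (k + N%:Z)))).
  have : annihilator R p 0 (elementary_xi R p_pr N a).
    apply/(annihilatorP p_pr) => k k0; rewrite chi_digit_xi ifF //; lia.
  rewrite -xi_cover => -[j _ /(coset_of_perpP p_pr) xj].
  exists (zeta j); first by apply/inE; exists j.
  move=> i; have iN := ltn_ord i.
  have := xj (i%:Z - N%:Z); rewrite zeta_low !chi_digit_xi !ifT; try lia.
  move=> <-; last by lia.
  by rewrite /a subrK /= valK.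
- move=> chi psi /inE[j chij] /inE[j' psij'] eqd.
  suff jj : j = j' by move=> k Nk; rewrite chij // psij' // jj.
  apply/val_inj; rewrite /= (jE j) (jE j'); apply: eq_bigr => i _.
  congr (nat_of_ord _ * _)%N; rewrite -!zeta_low -chij; last by lia.
  rewrite -psij'; [exact: eqd|lia].
Qed.

End ElementaryTrail.

(** * From the refinable function to the tree *)

Theorem theorem4p1 (R : realType) (p : nat) (p_pr : prime p) (p_ge3 : (3 <= p)%N)
    (N M : nat) (N_gt0 : (0 < N)%N) (M_gt0 : (0 < M)%N)
    (E : set (vchar R p)) (phi m0 : vchar R p -> R[i]) :
  E `<=` annihilator R p M%:Z ->
  elementary_set p_pr N M E ->
  step_space N M phi ->
  (forall chi, `|phi chi| = \1_E chi) ->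
  elementary_mask p_pr N m0 ->
  (forall chi, phi chi = m0 chi * phi (chi_dilateV chi)) ->
  exists T : rooted_tree 'F_p,
    [/\ valid_tree N T, has_height T (M + 2 * N) & generates p_pr N T E].
Proof.
move=> EM E_elem _ phiE _ phi_mask.
case: N N_gt0 E_elem => // n _ E_elem.
have [E_coset E1 E_word E_uniq] := elementary_set_digits E_elem.
have [alpha [_ _ _ _ E_level]] := E_elem.
(* If [phi] vanished at the shifted character, the mask equation would make it vanish at [chi],
   where its modulus is [1]. *)
have E_shift chi : E chi -> E (chi_dilateV chi).
  move=> Echi; apply: contrapT => nE.
  have phi0 : phi (chi_dilateV chi) = 0.
    by apply/eqP; rewrite -normr_eq0 phiE indicE memNset.
  have := phiE chi; rewrite phi_mask phi0 mulr0 normr0 indicE mem_set //.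
  by move/eqP; rewrite eq_sym oner_eq0.
have /choice [ch chP] : forall x : {ffun 'I_n.+1 -> 'F_p}, exists chi, E chi /\
    forall i : 'I_n.+1, chi_digit chi (i%:Z - n.+1%:Z) = x i.
  by move=> x; have [chi Echi chix] := E_word x; exists chi.
pose e x m := chi_digit (ch x) (m%:Z - n.+1%:Z).
have e_init x (i : 'I_n.+1) : e x i = x i by apply: (chP x).2.
pose word_of_char (chi : vchar R p) : {ffun 'I_n.+1 -> 'F_p} :=
  [ffun i : 'I_n.+1 => chi_digit chi (i%:Z - n.+1%:Z)].
have E_trail chi m : E chi -> chi_digit chi (m%:Z - n.+1%:Z) = e (word_of_char chi) m.
  move=> Echi; apply: E_uniq => //; [exact: (chP _).1| |lia].
  by move=> i; rewrite (chP _).2 ffunE.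
have e_next x m : e (next_word e x) m = e x m.+1.
  (* The shifted representative is again in [E], so its word determines all its digits. *)
  have -> : next_word e x = word_of_char (chi_dilateV (ch x)).
    apply/ffunP => i; rewrite !ffunE chi_digit_dilateV // /e.
    by congr chi_digit; lia.
  rewrite -E_trail; last exact/E_shift/(chP x).1.
  by rewrite chi_digit_dilateV // /e; congr chi_digit; lia.
have e_eventually0 x m : (M + n.+1 <= m)%N -> e x m = 0.
  move=> Mm; have /(annihilatorP p_pr) := EM _ (chP x).1; apply; lia.
have e_word0 m : e 0 m = 0.
  have -> : 0 = word_of_char 1%g by apply/ffunP => i; rewrite !ffunE chi_digit1.
  by rewrite -E_trail // chi_digit1.
exists (trail_tree e_init e_next e_eventually0 e_word0); split.
- exact: trail_valid.
(* The last level gives an element of [E] outside [annihilator (M - 1)]. Its digit at [M - 1], which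
   is entry [(M + N).-1] of its trail, is nonzero, as the height requires. *)
- have [|chi [[chi_in chi_out] Echi]] := E_level (M + n.+1).-1; first by lia.
  rewrite (_ : (M + 2 * n.+1 = n.+1 + (M + n.+1))%N); last by lia.
  apply: (@trail_height _ _ _ _ _ _ _ _ (word_of_char chi)).
  rewrite -E_trail //; apply/eqP => top0; apply: chi_out.
  apply/(annihilatorP p_pr) => k lk.
  have [->|nk] := eqVneq k ((M + n.+1).-1%:Z - n.+1%:Z); first exact: top0.
  by move/(annihilatorP p_pr): chi_in; apply; lia.
- apply: generates_trail_tree => chi; split=> [Echi|[x xE]].
    by exists (word_of_char chi) => m; apply: E_trail.
  apply: E_coset (chP x).1 _ => k Nk.
  have -> : k = (absz (k + n.+1%:Z)%R)%:Z - n.+1%:Z by lia.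
  by rewrite xE.
Qed.
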